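(* Let $m,n,r$ be positive integers with $r<\min\{m,n\}$, let $f:\mathbb{R}^{m\times n}\to\mathbb{R}$ be differentiable with locally Lipschitz continuous gradient, and let $0<\underline{\alpha}\le\overline{\alpha}<\infty$, $\beta,c\in(0,1)$, $\Delta\in(0,\infty)$. Consider a sequence generated by $\mathrm{P}^2\mathrm{GDR}$ (with these parameters, from any starting point $X_0\in\mathbb{R}^{m\times n}_{\le r}$) for the problem $\min_{X\in\mathbb{R}^{m\times n}_{\le r}}f(X)$. If this sequence is finite, then its last element is B-stationary. If it is infinite, then all of its accumulation points are B-stationary.
   Context: $\mathbb{R}^{m\times n}$ carries the Frobenius inner product $\langle X,Y\rangle=\operatorname{tr}(Y^\top X)$ and the induced norm $\|\cdot\|$. $\mathbb{R}^{m\times n}_{\le k}=\{X\in\mathbb{R}^{m\times n}\mid \operatorname{rank}X\le k\}$, $\mathbb{R}^{m\times n}_{k}=\{X\in\mathbb{R}^{m\times n}\mid\operatorname{rank}X=k\}$ (for $k=0$ both are $\{0_{m\times n}\}$). For a nonempty set $S$ and a point $x$, $P_S(x)=\operatorname{argmin}_{y\in S}\|x-y\|$ (a set). For $X\in S$, the tangent cone $T_S(X)$ is the set of all $V$ for which there exist sequences $(X_i)$ in $S$ converging to $X$ and $(t_i)$ in $(0,\infty)$ with $(X_i-X)/t_i\to V$; the regular normal cone is its polar, $\widehat N_S(X)=\{W\mid\langle V,W\rangle\le 0\ \forall V\in T_S(X)\}$. A point $X\in\mathbb{R}^{m\times n}_{\le r}$ is B-stationary if $-\nabla f(X)\in\widehat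 N_{\mathbb{R}^{m\times n}_{\le r}}(X)$. All elements of $P_{T_{\mathbb{R}^{m\times n}_{\le r}}(X)}(-\nabla f(X))$ have the same norm, denoted $\mathrm{s}(X;f,\mathbb{R}^{m\times n}_{\le r})$. For $\Delta>0$, $\operatorname{rank}_\Delta X$ is the number of singular values of $X$ that are greater than $\Delta$. $\mathrm{P}^2\mathrm{GD}$ map: for $X\in\mathbb{R}^{m\times n}_{\le r}$, $\mathrm{P}^2\mathrm{GD}(X)$ is the set of all possible outputs $Y$ of the following procedure. Choose $G\in P_{T_{\mathbb{R}^{m\times n}_{\le r}}(X)}(-\nabla f(X))$, $\alpha\in[\underline{\alpha},\overline{\alpha}]$ and $Y\in P_{\mathbb{R}^{m\times n}_{\le r}}(X+\alpha G)$; while $f(Y)>f(X)-c\,\alpha\,\mathrm{s}(X;f,\mathbb{R}^{m\times n}_{\le r})^2$, replace $\alpha$ by $\alpha\beta$ and choose $Y\in P_{\mathbb{R}^{m\times n}_{\le r}}(X+\alpha G)$; return $Y$. $\mathrm{P}^2\mathrm{GDR}$ map: for $X\in\mathbb{R}^{m\times n}_{\le r}$, $\mathrm{P}^2\mathrm{GDR}(X)$ is the set of all possible outputs $Y$ of the following procedure. For every $i\in\{0,\dots,\operatorname{rank}X-\operatorname{rank}_\Delta X\}$, choose $\hat X^i\in P_{\mathbb{R}^{m\times n}_{\operatorname{rank}X-i}}(X)$ and $\tilde X^i\in\mathrm{P}^2\mathrm{GD}(\hat X^i)$; return some $Y$ minimizing $f$ over the finite set $\{\tilde X^i\mid 0\le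 i\le\operatorname{rank}X-\operatorname{rank}_\Delta X\}$. A sequence generated by $\mathrm{P}^2\mathrm{GDR}$ starts at some $X_0\in\mathbb{R}^{m\times n}_{\le r}$; as long as $X_i$ is not B-stationary, some $X_{i+1}\in\mathrm{P}^2\mathrm{GDR}(X_i)$ is chosen; the sequence stops at $X_i$ if $X_i$ is B-stationary. *)

(* Defs.v *)
From HB Require Import structures.
From mathcomp Require Import all_boot all_order all_algebra.
From mathcomp Require Import polyrcf.
From mathcomp Require Import all_classical all_reals all_analysis.

Set Implicit Arguments.
Unset Strict Implicit.
Unset Printing Implicit Defensive.

Import Order.TTheory GRing.Theory Num.Theory.
Import numFieldNormedType.Exports.

Local Open Scope classical_set_scope.
Local Open Scope ring_scope.

(* Limits, neighborhoods, cluster points and differentiability of matrices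
   refer to the max-norm instance of MathComp-Analysis, which is equivalent to
   the Frobenius norm; everything metric is stated with the Frobenius norm. *)

Section Frobenius.
Context {R : realType} {m n : nat}.
Implicit Types X Y V W : 'M[R]_(m, n).

Definition frob X Y : R := \tr (Y^T *m X).

Definition fnorm X : R := Num.sqrt (frob X X).

(* The Riesz representative of the differential, see [gradE]. *)
Definition grad (f : 'M[R]_(m, n) -> R) X : 'M[R]_(m, n) :=
  \matrix_(i, j) 'd f X (delta_mx i j).

Lemma frobE X Y : frob X Y = \sum_i \sum_j X i j * Y i j.
Proof.
rewrite /frob /mxtrace exchange_big; apply: eq_bigr => j _.
by rewrite mxE; apply: eq_bigr => i _; rewrite mxE mulrC.
Qed.

Lemma gradE (f : 'M[R]_(m, n) -> R) X V :
  'd f X V = frob (grad f X) V.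
Proof.
rewrite frobE {1}(matrix_sum_delta V) linear_sum; apply: eq_bigr => i _.
rewrite linear_sum; apply: eq_bigr => j _.
by rewrite linearZ /= mxE mulrC.
Qed.

Definition locally_lipschitz (F : 'M[R]_(m, n) -> 'M[R]_(m, n)) : Prop :=
  forall X, exists L : R, exists2 U, nbhs X U &
    forall Y Z, U Y -> U Z -> fnorm (F Y - F Z) <= L * fnorm (Y - Z).

Definition proj (S : set 'M[R]_(m, n)) X : set 'M[R]_(m, n) :=
  [set Y | S Y /\ forall Z, S Z -> fnorm (X - Y) <= fnorm (X - Z)].

Definition tangent_cone (S : set 'M[R]_(m, n)) X : set 'M[R]_(m, n) :=
  [set V | exists (x : nat -> 'M[R]_(m, n)) (t : nat -> R),
    [/\ forall i, S (x i), forall i, 0 < t i, x @ \oo --> X &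
        (fun i => (t i)^-1 *: (x i - X)) @ \oo --> V]].

Definition regular_normal_cone (S : set 'M[R]_(m, n)) X : set 'M[R]_(m, n) :=
  [set W | forall V, tangent_cone S X V -> frob V W <= 0].

Definition rank_le (k : nat) : set 'M[R]_(m, n) :=
  [set X | (\rank X <= k)%N].

Definition rank_eq (k : nat) : set 'M[R]_(m, n) :=
  [set X | \rank X = k].

(* Square roots of the eigenvalues of X^T X, repeated with multiplicity. If
   m < n, the list has n - m more zeros than the usual list of length m; they
   play no role in [rank_gt] because only thresholds D > 0 are used. *)
Definition singular_values X : seq R :=
  let p := char_poly (X^T *m X) in
  flatten [seq nseq (mup x p) (Num.sqrt x) | x <- rootsR p].

Definition rank_gt (D : R) X : nat :=
  count (fun s => D < s) (singular_values X).

End Frobenius.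

Section Algorithm.
Context {R : realType} {m n : nat}.
Variables (f : 'M[R]_(m, n) -> R) (r : nat).
Variables (alo ahi beta c D : R).
Implicit Types X Y G : 'M[R]_(m, n).

Definition B_stationary X : Prop :=
  rank_le r X /\ regular_normal_cone (rank_le r) X (- grad f X).

Definition descent_directions X : set 'M[R]_(m, n) :=
  proj (tangent_cone (rank_le r) X) (- grad f X).

(* All the elements of [descent_directions X] have the same norm. *)
Definition stationarity_measure X : R :=
  xget 0 (fnorm @` descent_directions X).

(* [backtrack X G a Y Z]: from the step size a and the candidate Y, the while
   loop can terminate with output Z. *)
Inductive backtrack X G : R -> 'M[R]_(m, n) -> 'M[R]_(m, n) -> Prop :=
| backtrack_stop a Y :
    f Y <= f X - c * a * stationarity_measure X ^+ 2 ->
    backtrack X G a Y Y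
| backtrack_step a Y Y' Z :
    f X - c * a * stationarity_measure X ^+ 2 < f Y ->
    proj (rank_le r) (X + (a * beta) *: G) Y' ->
    backtrack X G (a * beta) Y' Z ->
    backtrack X G a Y Z.

Definition P2GD X : set 'M[R]_(m, n) :=
  [set Z | exists G a Y,
    [/\ descent_directions X G, alo <= a <= ahi,
        proj (rank_le r) (X + a *: G) Y & backtrack X G a Y Z]].

Definition P2GDR X : set 'M[R]_(m, n) :=
  [set Y | exists Xhat Xtilde : 'I_(\rank X - rank_gt D X).+1 -> 'M[R]_(m, n),
    [/\ forall i : 'I_(\rank X - rank_gt D X).+1,
          proj (rank_eq (\rank X - i)%N) X (Xhat i),
        forall i, P2GD (Xhat i) (Xtilde i) &
        exists2 i, Y = Xtilde i & forall j, f Y <= f (Xtilde j)]].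

(* A finite or infinite sequence, [None] meaning that it has stopped. *)
Definition generated_by_P2GDR (x : nat -> option 'M[R]_(m, n)) : Prop :=
  [/\ exists2 X0, x 0%N = Some X0 & rank_le r X0,
      forall i X, x i = Some X -> ~ B_stationary X ->
        exists2 Y, x i.+1 = Some Y & P2GDR X Y,
      forall i X, x i = Some X -> B_stationary X -> x i.+1 = None &
      forall i, x i = None -> x i.+1 = None].

End Algorithm.

(* Main.v *)
(* Let X be an accumulation point of rank k <= r that is not B-stationary.
   Whenever an iterate Z is close to X, one of the rank reductions of Z has
   rank exactly k and is at least as close to Z as X is, so it suffices that
   P2GD decreases f by a fixed amount from every point of rank k near X; this
   contradicts the monotonicity of f along the sequence and the continuity of f.
   If Z H Z = Z and H Z H = H, then a direction G is tangent to the matrices of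
   rank at most r at Z iff the rank of (1 - Z H) G (1 - H Z) is at most
   r - rank Z, and then Z + G + (1 - Z H) G H G has rank at most r. A
   generalized inverse H of X deforms continuously to the points of rank k near
   X, which yields, uniformly in Z, a quadratic bound on the distance from
   Z + a G to the matrices of rank at most r (hence the Armijo condition for
   all small a) and a positive lower bound on the stationarity measure.
   That the number of singular values of Z above D is at most k follows from
   the diagonalizability of Z^T Z. *)
Require Import Defs.
From HB Require Import structures.
From mathcomp Require Import all_boot all_order all_algebra.
From mathcomp Require Import polyrcf ring lra.
From mathcomp Require Import all_classical all_reals all_analysis.

Set Implicit Arguments.
Unset Strict Implicit.
Unset Printing Implicit Defensive.

Import Order.TTheory GRing.Theory Num.Theory.
Import numFieldNormedType.Exports.

Local Open Scope classical_set_scope.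
Local Open Scope ring_scope.

Lemma mxE_add (R : zmodType) m n (A B : 'M[R]_(m, n)) i j : (A + B) i j = A i j + B i j.
Proof. by rewrite mxE. Qed.

Lemma mxE_opp (R : zmodType) m n (A : 'M[R]_(m, n)) i j : (- A) i j = - A i j.
Proof. by rewrite mxE. Qed.

(** * Generalized inverses and a curve of bounded rank *)

Section GeneralizedInverse.
Context {F : fieldType} {m n : nat}.
Implicit Types (Z G : 'M[F]_(m, n)) (H : 'M[F]_(n, m)).

(** A reflexive generalized inverse. The projections [Z *m H] and [H *m Z] may be oblique, unlike
    those of the Moore-Penrose inverse, which lets [H] follow [Z] by an explicit rational
    formula. *)
Definition ginv Z H : Prop := Z *m H *m Z = Z /\ H *m Z *m H = H.

Lemma ginv_exists Z : exists H, ginv Z H.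
Proof.
have [K ZK] : exists K, Z *m K *m Z = Z by exists (pinvmx Z); apply: mulmxKpV.
exists (K *m Z *m K); split; first by rewrite !mulmxA ZK ZK.
by rewrite -!mulmxA (mulmxA Z) (mulmxA (Z *m _)) ZK (mulmxA Z) (mulmxA (Z *m _)) ZK.
Qed.

Lemma ginv_rank Z H : ginv Z H -> \rank H = \rank Z.
Proof.
move=> [ZHZ HZH]; apply/eqP; rewrite eqn_leq; apply/andP; split.
  by rewrite -{1}HZH; apply: leq_trans (mxrankM_maxl _ _) (mxrankM_maxr _ _).
by rewrite -{1}ZHZ; apply: leq_trans (mxrankM_maxl _ _) (mxrankM_maxr _ _).
Qed.

(** The rows of [Z - Z *m H *m Z] lie in the row space of [Z] and are annihilated by [H *m Z], while
    [Z *m (H *m Z)] has rank at least [\rank H]; rank-nullity adds the two. *)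
Lemma rank_outer_inverse Z H : H *m Z *m H = H ->
  (\rank (Z - Z *m H *m Z)%R + \rank H <= \rank Z)%N.
Proof.
move=> HZH; rewrite -(mxrank_mul_ker Z (H *m Z)) addnC leq_add //.
  have HE : H *m (Z *m (H *m Z)) *m H = H by rewrite !mulmxA HZH HZH.
  by rewrite -{1}HE; apply: leq_trans (mxrankM_maxl _ _) (mxrankM_maxr _ _).
apply: mxrankS; rewrite sub_capmx; apply/andP; split.
  by rewrite -{1}(mul1mx Z) -mulmxBl submxMl.
by apply/sub_kermxP; rewrite mulmxBl -!mulmxA (mulmxA H) (mulmxA (H *m Z)) HZH subrr.
Qed.

Lemma ginv_of_outer_inverse Z H :
  H *m Z *m H = H -> (\rank Z <= \rank H)%N -> ginv Z H.
Proof.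
move=> HZH rk; split=> //; apply/esym/eqP; rewrite -subr_eq0 -mxrank_eq0.
rewrite -leqn0 -(leq_add2r (\rank H)) add0n.
exact: leq_trans (rank_outer_inverse HZH) rk.
Qed.

(** If [ginv Z H], this is the component of [G] transverse to the tangent space at [Z] of the
    matrices of rank [\rank Z]. *)
Definition normal_part Z H G : 'M[F]_(m, n) :=
  (1%:M - Z *m H) *m G *m (1%:M - H *m Z).

Definition tangent_curve Z H G : 'M[F]_(m, n) :=
  Z + G + (1%:M - Z *m H) *m G *m H *m G.

Lemma normal_partB Z H G G' :
  normal_part Z H (G - G') = normal_part Z H G - normal_part Z H G'.
Proof. by rewrite /normal_part (mulmxBr _ G) mulmxBl. Qed.

Lemma normal_partZ Z H a G : normal_part Z H (a *: G) = a *: normal_part Z H G.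
Proof. by rewrite /normal_part -scalemxAr -scalemxAl. Qed.

Lemma normal_partK Z H G : ginv Z H ->
  normal_part Z H (normal_part Z H G) = normal_part Z H G.
Proof.
move=> [ZHZ HZH]; rewrite /normal_part !mulmxA.
have -> : (1%:M - Z *m H) *m (1%:M - Z *m H) = 1%:M - Z *m H.
  by rewrite mulmxBr mulmx1 mulmxBl mul1mx !mulmxA ZHZ subrr subr0.
rewrite -mulmxA; congr (_ *m _).
by rewrite mulmxBr mulmx1 mulmxBl mul1mx !mulmxA HZH subrr subr0.
Qed.

Lemma rank_normal_part Z H G : (\rank (normal_part Z H G) <= \rank G)%N.
Proof. by apply: leq_trans (mxrankM_maxl _ _) (mxrankM_maxr _ _). Qed.

(** Up to the normal part, the curve is a product with [H] as a factor, so of rank at most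
    [\rank H = \rank Z]. *)
Lemma tangent_curve_rank Z H G : ginv Z H ->
  (\rank (tangent_curve Z H G) <= \rank Z + \rank (normal_part Z H G))%N.
Proof.
move=> gZH; have [ZHZ HZH] := gZH.
have -> : tangent_curve Z H G =
    (Z + (1%:M - Z *m H) *m G *m H *m Z) *m H *m (Z + Z *m H *m G)
    + normal_part Z H G.
  have ZHZr : Z *m (H *m Z) = Z by rewrite mulmxA.
  have HZHr (A : 'M[F]_(m, n)) : H *m (Z *m (H *m A)) = H *m A by rewrite !mulmxA HZH.
  rewrite /tangent_curve /normal_part; set P := 1%:M - Z *m H.
  have PE : G = P *m G + Z *m (H *m G) by rewrite mulmxBl mul1mx mulmxA subrK.
  clearbody P; rewrite mulmxBr mulmx1 !mulmxDl !mulmxDr -!mulmxA !HZHr ZHZr.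
  by rewrite {1}PE; apply/matrixP => i j; rewrite !(mxE_add, mxE_opp); ring.
apply: leq_trans (mxrank_add _ _) _; rewrite leq_add2r -(ginv_rank gZH).
by apply: leq_trans (mxrankM_maxl _ _) (mxrankM_maxr _ _).
Qed.

(** Since [(Z + E) *m H = Z *m H + U - 1%:M] and [U] fixes [1%:M - Z *m H], the outer identity
    passes to [H']. The last identity puts [E] between two factors that converge as [E] tends to 0,
    so the residual can be divided by a step size. *)
Lemma outer_inverse_perturbation Z E H (U := 1%:M + E *m H) :
  H *m Z *m H = H -> U \in unitmx ->
  let H' := H *m invmx U in
  [/\ H' *m (Z + E) *m H' = H', \rank H' = \rank H &
    Z *m H *m Z = Z -> Z + E - (Z + E) *m H' *m (Z + E) =
      (1%:M - (Z + E) *m H') *m E *m (1%:M - H *m Z)].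
Proof.
move=> HZH Uu H'.
have HU : H' *m U = H by rewrite mulmxKV.
have UK : invmx U *m (1%:M - Z *m H) = 1%:M - Z *m H.
  apply: (canLR (mulKmx Uu)); rewrite mulmxDl mul1mx -mulmxA mulmxBr mulmx1.
  by rewrite mulmxA HZH subrr mulmx0 addr0.
have H'ZH : H' *m Z *m H = H'.
  apply/esym/eqP; rewrite -subr_eq0 -{1}(mulmx1 H') -(mulmxA H') -mulmxBr.
  by rewrite /H' -mulmxA UK mulmxBr mulmx1 mulmxA HZH subrr.
have H'K : H' *m (Z + E) *m H' = H'.
  have ZEH : (Z + E) *m H = Z *m H + U - 1%:M.
    by rewrite mulmxDl /U -addrA [1%:M + _]addrC addrK.
  rewrite -mulmxA {2}/H' (mulmxA (Z + E)) ZEH mulmxBl mulmxDl mulmxV //.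
  rewrite mulmxBr mulmxDr mulmx1 mul1mx !mulmxA H'ZH.
  by rewrite addrC addrA addNr add0r.
split=> //; first by rewrite mxrankMfree // row_free_unit unitmx_inv.
move=> ZHZ; set P := 1%:M - _.
have PH' : P *m (Z + E) *m H' = 0.
  rewrite /P !mulmxBl mul1mx -(mulmxA ((Z + E) *m H')) -(mulmxA (Z + E)).
  by rewrite (mulmxA H') H'K subrr.
have PH : P *m (Z + E) *m (H *m Z) = 0.
  by rewrite mulmxA -[X in _ *m X *m Z]HU (mulmxA _ H') PH' !mul0mx.
transitivity (P *m (Z + E) *m (1%:M - H *m Z)).
  by rewrite mulmxBr mulmx1 PH subr0 /P mulmxBl mul1mx.
by rewrite (mulmxDr P) mulmxDl -(mulmxA P Z) mulmxBr mulmx1 mulmxA ZHZ subrr mulmx0 add0r.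
Qed.

End GeneralizedInverse.

(** * Multiplicities of eigenvalues of symmetric matrices *)

Lemma det_sub_mul_comm (R : comNzRingType) n p (y : R)
    (A : 'M[R]_(n, p)) (B : 'M[R]_(p, n)) :
  y ^+ p * \det (y%:M - A *m B) = y ^+ n * \det (y%:M - B *m A).
Proof.
(* Sylvester's identity: [M] is multiplied by two block triangular matrices, which also covers a
   non-invertible [y] such as ['X - a%:P]. *)
pose M := block_mx y%:M A B 1%:M.
have -> : \det (y%:M - A *m B) = \det M.
  have <- : \det (M *m block_mx 1%:M 0 (- B) 1%:M) = \det M.
    by rewrite det_mulmx det_lblock !det1 !mulr1.
  rewrite mulmx_block !(mulmx1, mul1mx, mulmx0, add0r) mulmxN subrr.
  by rewrite det_ublock det1 mulr1.
rewrite -(det_scalar p y).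
have -> : \det (y%:M : 'M[R]_p) = \det (block_mx (1%:M : 'M[R]_n) 0 (- B) (y%:M : 'M[R]_p)).
  by rewrite det_lblock det1 mul1r.
rewrite -det_mulmx mulmx_block !(mulmx1, mul1mx, mul0mx, addr0).
rewrite mul_mx_scalar mul_scalar_mx scalerN addNr det_ublock det_scalar.
by rewrite mulNmx [- _ + _]addrC.
Qed.

(** By the rank hypothesis, a full-rank factorization [N = L *m R] has [R *m L] invertible.
    Sylvester's identity gives [('X - a%:P) ^+ p * char_poly A = ('X - a%:P) ^+ n * d] with [d]
    nonzero at [a], so the multiplicity is [n - p]. *)
Lemma mup_char_poly (F : fieldType) n (A : 'M[F]_n) (a : F) :
  let N := A - a%:M in \rank (N *m N) = \rank N ->
  mup a (char_poly A) = \rank (eigenspace A a).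
Proof.
move=> N rkNN; set p := \rank N; set L := col_base N; set R := row_base N.
have LR : L *m R = N by apply: mulmx_base.
have RLu : R *m L \in unitmx.
  rewrite -row_free_unit -row_leq_rank.
  apply: (@leq_trans (\rank (N *m N))); first by rewrite rkNN.
  rewrite -{1 2}LR -mulmxA (mulmxA R).
  by apply: leq_trans (mxrankM_maxr _ _) (mxrankM_maxl _ _).
have pE : char_poly A = \det (('X - a%:P)%:M - map_mx polyC L *m map_mx polyC R).
  rewrite -map_mxM LR /char_poly /char_poly_mx; congr (\det _).
  by rewrite /N map_mxB map_scalar_mx raddfB /= opprB addrA subrK.
have := det_sub_mul_comm ('X - a%:P) (map_mx polyC L) (map_mx polyC R).
rewrite -pE -map_mxM => eqp.
set d := \det (_ - map_mx _ (R *m L)) in eqp.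
have da : ~~ root d a.
  rewrite /root -horner_evalE -det_map_mx map_mxB map_scalar_mx /=.
  rewrite horner_evalE !hornerE subrr -map_mx_comp /=.
  have -> : map_mx (horner_eval a \o polyC) (R *m L) = R *m L.
    by apply/matrixP => i j; rewrite [LHS]mxE /= horner_evalE hornerC.
  rewrite raddf0 sub0r -scaleN1r detZ mulf_neq0 ?signr_eq0 //.
  by rewrite -unitfE -unitmxE.
have d0 : d != 0 by apply: contraNneq da => ->; rewrite root0.
have Xa0 k : ('X - a%:P) ^+ k != 0 by rewrite expf_neq0 ?polyXsubC_eq0.
have c0 : char_poly A != 0 by rewrite monic_neq0 ?char_poly_monic.
have := congr1 (mup a) eqp; rewrite !mupM //.
rewrite !mup_XsubCX eqxx (mupNroot da) addn0 => e.
by rewrite mxrank_ker -[X in (X - _)%N]e addKn.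
Qed.

Lemma mulmx_tr_eq0 (R : realDomainType) m n (A : 'M[R]_(m, n)) :
  A *m A^T = 0 -> A = 0.
Proof.
move=> AA; apply/matrixP => i j; rewrite mxE; apply/eqP.
have /eqP := congr1 (fun B : 'M[R]_m => B i i) AA; rewrite !mxE.
under eq_bigr do rewrite mxE -expr2.
rewrite psumr_eq0 => [/allP/(_ j)|? _]; last exact: sqr_ge0.
by rewrite mem_index_enum sqrf_eq0 => /(_ isT).
Qed.

(** If [x *m N *m N = 0], then [x *m N] times its transpose is 0, so [x *m N = 0]: the two kernels
    agree. *)
Lemma rank_sqr_sym (R : realFieldType) n (N : 'M[R]_n) :
  N^T = N -> \rank (N *m N) = \rank N.
Proof.
move=> symN; apply/eqP; rewrite eqn_leq mxrankM_maxl /=.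
have : (kermx (N *m N) <= kermx N)%MS.
  apply/sub_kermxP/mulmx_tr_eq0; rewrite trmx_mul symN !mulmxA.
  by rewrite -(mulmxA (kermx _) N N) mulmx_ker mul0mx.
by move/mxrankS; rewrite !mxrank_ker leq_sub2lE ?rank_leq_row.
Qed.

(** [E] is the sum of the eigenspaces for the elements of [s]. They are mutually orthogonal, so on
    [E] the form of [A] is a sum of squared norms of components, weighted by elements of [s]. *)
Lemma sum_mup_char_poly_sym (R : realFieldType) n (A : 'M[R]_n) (s : seq R) :
  A^T = A -> uniq s ->
  exists2 E : 'M[R]_n, \rank E = (\sum_(x <- s) mup x (char_poly A))%N &
    forall b (v : 'rV[R]_n), (forall x, x \in s -> b < x) -> (v <= E)%MS -> v != 0 ->
      b * (v *m v^T) 0 0 < (v *m A *m v^T) 0 0.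
Proof.
move=> symA us; pose a (i : 'I_(size s)) := s`_i.
exists (\sum_i eigenspace A (a i))%MS.
  have := @mxdirect_sum_eigenspace R _ n A predT a.
  move=> /(_ _)/mxdirectP /= -> ; last first.
    by move=> i j _ _ /eqP; rewrite nth_uniq // => /eqP/val_inj.
  rewrite (big_nth 0) big_mkord; apply: eq_bigr => i _.
  by rewrite mup_char_poly // rank_sqr_sym // linearB /= symA tr_scalar_mx.
move=> b v ltb /sub_sumsmxP[u uE] v0.
have [w vE wA] : exists2 w : 'I_(size s) -> 'rV[R]_n,
    v = \sum_i w i & forall i, w i *m A = a i *: w i.
  by exists (fun i => u i *m eigenspace A (a i)) => // i; apply/eigenspaceP/submxMl.
have trw j : a j *: (w j)^T = A *m (w j)^T.
  by rewrite -{1}symA -trmx_mul wA linearZ.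
have ww i j : i != j -> w i *m (w j)^T = 0.
  move=> ij; have : a i *: (w i *m (w j)^T) = a j *: (w i *m (w j)^T).
    by rewrite scalemxAl -wA [RHS]scalemxAr trw mulmxA.
  move/eqP; rewrite -subr_eq0 -scalerBl scaler_eq0 => /orP[|/eqP//].
  by rewrite subr_eq0 nth_uniq // => /eqP/val_inj/eqP; rewrite (negPf ij).
have vv c : (\sum_i c i *: w i) *m v^T = \sum_i c i *: (w i *m (w i)^T).
  rewrite mulmx_suml; apply: eq_bigr => i _; rewrite -scalemxAl vE linear_sum.
  rewrite mulmx_sumr (bigD1 i) //= big1 ?addr0 // => j ji.
  by rewrite ww // eq_sym.
have -> : v *m v^T = \sum_i (w i *m (w i)^T).
  rewrite -[RHS](eq_bigr _ (fun i _ => scale1r _)) -vv {1}vE.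
  by under [in RHS]eq_bigr do rewrite scale1r.
have -> : v *m A *m v^T = \sum_i a i *: (w i *m (w i)^T).
  by rewrite -vv {1}vE mulmx_suml; under eq_bigr do rewrite wA.
have w_ge0 i : 0 <= (w i *m (w i)^T) 0 0.
  by rewrite mxE sumr_ge0 // => j _; rewrite [_^T _ _]mxE -expr2 sqr_ge0.
have qi_gt0 i : w i != 0 -> 0 < (w i *m (w i)^T) 0 0.
  rewrite lt_neqAle w_ge0 andbT; apply: contraNneq => qi0.
  apply/eqP/mulmx_tr_eq0/matrixP => j k.
  by rewrite !ord1 -qi0 [RHS]mxE.
have [i wi0] : exists i, w i != 0.
  apply/existsP; apply: contraNT v0; rewrite negb_exists => /forallP w0.
  by rewrite vE big1 // => i _; apply/eqP; have := w0 i; rewrite negbK.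
have ba j : b < a j by apply/ltb/mem_nth.
rewrite !summxE mulr_sumr (bigD1 i) // [ltRHS](bigD1 i) //= [_ 0 0 in ltRHS]mxE.
apply: ltr_leD; first by rewrite ltr_pM2r ?qi_gt0.
by apply: ler_sum => j _; rewrite [leRHS]mxE ler_wpM2r ?w_ge0 ?ltW.
Qed.

(** * The Frobenius inner product and norm *)

Section FrobeniusTheory.
Context {R : realType}.

Section Inner.
Context {m n : nat}.
Implicit Types X Y Z : 'M[R]_(m, n).

Lemma frobC X Y : frob X Y = frob Y X.
Proof.
by rewrite !frobE; apply: eq_bigr => i _; apply: eq_bigr => j _; rewrite mulrC.
Qed.

Lemma frobDl X Y Z : frob (X + Y) Z = frob X Z + frob Y Z.
Proof. by rewrite /frob mulmxDr linearD. Qed.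

Lemma frobDr X Y Z : frob X (Y + Z) = frob X Y + frob X Z.
Proof. by rewrite frobC frobDl !(frobC X). Qed.

Lemma frobZl a X Y : frob (a *: X) Y = a * frob X Y.
Proof. by rewrite /frob -scalemxAr linearZ. Qed.

Lemma frobZr a X Y : frob X (a *: Y) = a * frob X Y.
Proof. by rewrite frobC frobZl frobC. Qed.

Lemma frobNl X Y : frob (- X) Y = - frob X Y.
Proof. by rewrite /frob mulmxN linearN. Qed.

Lemma frobNr X Y : frob X (- Y) = - frob X Y.
Proof. by rewrite frobC frobNl frobC. Qed.

Lemma frobBl X Y Z : frob (X - Y) Z = frob X Z - frob Y Z.
Proof. by rewrite frobDl frobNl. Qed.

Lemma frob_ge0 X : 0 <= frob X X.
Proof.
rewrite frobE sumr_ge0 // => i _; rewrite sumr_ge0 // => j _.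
by rewrite -expr2 sqr_ge0.
Qed.

Lemma fnorm_ge0 X : 0 <= fnorm X.
Proof. exact: sqrtr_ge0. Qed.

Lemma sqr_fnorm X : fnorm X ^+ 2 = frob X X.
Proof. by rewrite sqr_sqrtr // frob_ge0. Qed.

Lemma fnormZ a X : fnorm (a *: X) = `|a| * fnorm X.
Proof. by rewrite /fnorm frobZl frobZr mulrA -expr2 sqrtrM ?sqr_ge0 // sqrtr_sqr. Qed.

Lemma fnormN X : fnorm (- X) = fnorm X.
Proof. by rewrite /fnorm frobNl frobNr opprK. Qed.

Lemma fnormB X Y : fnorm (X - Y) = fnorm (Y - X).
Proof. by rewrite -fnormN opprB. Qed.

Lemma fnorm0 : fnorm (0 : 'M[R]_(m, n)) = 0.
Proof. by rewrite -(scale0r 0) fnormZ normr0 mul0r. Qed.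

Lemma ler_entry_fnorm X i j : `|X i j| <= fnorm X.
Proof.
rewrite -sqrtr_sqr ler_sqrt ?frob_ge0 // frobE (bigD1 i) //= (bigD1 j) //= -expr2 -addrA.
rewrite lerDl addr_ge0 // sumr_ge0 // => k _; first by rewrite -expr2 sqr_ge0.
by rewrite sumr_ge0 // => l _; rewrite -expr2 sqr_ge0.
Qed.

Lemma fnorm_eq0 X : fnorm X = 0 -> X = 0.
Proof.
move=> X0; apply/matrixP => i j; apply/eqP; rewrite mxE -normr_le0 -X0.
exact: ler_entry_fnorm.
Qed.

Lemma cauchy_schwarz X Y : frob X Y <= fnorm X * fnorm Y.
Proof.
have [X0|Xn0] := eqVneq (fnorm X) 0.
  by rewrite X0 mul0r (fnorm_eq0 X0) -(scale0r 0) frobZl mul0r.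
have [Y0|Yn0] := eqVneq (fnorm Y) 0.
  by rewrite Y0 mulr0 (fnorm_eq0 Y0) -(scale0r 0) frobZr mul0r.
have xy0 : 0 < fnorm X * fnorm Y by rewrite mulr_gt0 // lt0r ?Xn0 ?Yn0 fnorm_ge0.
(* With [x], [y] the two norms and [c] the inner product, this square equals
   [2 * x * y * (x * y - c)]. *)
have := frob_ge0 (fnorm Y *: X - fnorm X *: Y).
rewrite !(frobDl, frobDr, frobNl, frobNr, frobZl, frobZr) -!sqr_fnorm (frobC Y X).
move: (frob X Y) xy0 => c; move: (fnorm X) (fnorm Y) => x y xy0 H.
by rewrite -(ler_pM2l xy0); nra.
Qed.

Lemma cauchy_schwarz_abs X Y : `|frob X Y| <= fnorm X * fnorm Y.
Proof.
rewrite ler_norml cauchy_schwarz andbT lerNl -frobNl -(fnormN X).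
exact: cauchy_schwarz.
Qed.

Lemma ler_fnormD X Y : fnorm (X + Y) <= fnorm X + fnorm Y.
Proof.
rewrite -ler_sqr ?nnegrE ?addr_ge0 ?fnorm_ge0 //.
rewrite sqr_fnorm !(frobDl, frobDr) sqrrD -!sqr_fnorm (frobC Y X).
by have := cauchy_schwarz X Y; lra.
Qed.

End Inner.

Lemma fnormT m n (X : 'M[R]_(m, n)) : fnorm X^T = fnorm X.
Proof.
congr Num.sqrt; rewrite !frobE exchange_big.
by apply: eq_bigr => i _; apply: eq_bigr => j _; rewrite !mxE.
Qed.

(** Cauchy-Schwarz bounds each entry by the norms of a row of [A] and a column of [B]; the sum of
    the squared bounds factors. *)
Lemma ler_fnormM m n p (A : 'M[R]_(m, n)) (B : 'M[R]_(n, p)) :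
  fnorm (A *m B) <= fnorm A * fnorm B.
Proof.
rewrite -ler_sqr ?nnegrE ?mulr_ge0 ?fnorm_ge0 // exprMn !sqr_fnorm.
have -> : frob A A = \sum_i fnorm (row i A) ^+ 2.
  rewrite frobE; apply: eq_bigr => i _; rewrite sqr_fnorm frobE big_ord1.
  by apply: eq_bigr => j _; rewrite !mxE.
have -> : frob B B = \sum_j fnorm (col j B)^T ^+ 2.
  rewrite frobE exchange_big; apply: eq_bigr => j _; rewrite sqr_fnorm frobE big_ord1.
  by apply: eq_bigr => i _; rewrite !mxE.
rewrite frobE mulr_suml ler_sum // => i _; rewrite mulr_sumr ler_sum // => j _.
have -> : (A *m B) i j = frob (row i A) (col j B)^T.
  by rewrite mxE frobE big_ord1; apply: eq_bigr => k _; rewrite !mxE.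
rewrite -expr2 -exprMn -real_normK ?num_real // ler_sqr ?nnegrE ?mulr_ge0 ?fnorm_ge0 //.
exact: cauchy_schwarz_abs.
Qed.

End FrobeniusTheory.

(** * Limits of matrix-valued functions *)

Section MatrixLimits.
Context {R : realType} {T : Type} (F : set_system T) {FF : Filter F}.

Lemma cvg_mxP m n (f : T -> 'M[R]_(m, n)) (A : 'M[R]_(m, n)) :
  (forall i j, (fun t => f t i j) @ F --> A i j) <-> f @ F --> A.
Proof.
split=> [fA|fA i j].
  apply/cvgrPdist_lt => e e0.
  have : \forall t \near F, forall k : 'I_m * 'I_n, `|A k.1 k.2 - f t k.1 k.2| < e.
    by apply: filter_forall => k; move/cvgrPdist_lt: (fA k.1 k.2); apply.
  apply: filterS => t At; rewrite [ltLHS]/Num.norm /= mx_normrE.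
  by apply/bigmax_ltP; split=> // k _; rewrite !mxE.
exact: cvg_comp fA (@coord_continuous _ m n i j A).
Qed.

Lemma cvg_mulmx m n p (f : T -> 'M[R]_(m, n)) (g : T -> 'M[R]_(n, p))
    (A : 'M[R]_(m, n)) (B : 'M[R]_(n, p)) :
  f @ F --> A -> g @ F --> B -> (fun t => f t *m g t) @ F --> A *m B.
Proof.
move=> /cvg_mxP fA /cvg_mxP gB; apply/cvg_mxP => i j.
under eq_cvg do rewrite mxE; rewrite mxE.
by apply: cvg_big => [|k _]; [exact: add_continuous|exact: cvgM].
Qed.

Lemma cvg_frob m n (f g : T -> 'M[R]_(m, n)) (A B : 'M[R]_(m, n)) :
  f @ F --> A -> g @ F --> B -> (fun t => frob (f t) (g t)) @ F --> frob A B.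
Proof.
move=> /cvg_mxP fA /cvg_mxP gB.
under eq_cvg do rewrite frobE; rewrite frobE.
apply: cvg_big => [|i _]; first exact: add_continuous.
by apply: cvg_big => [|j _]; [exact: add_continuous|exact: cvgM].
Qed.

Lemma cvg_fnorm m n (f : T -> 'M[R]_(m, n)) (A : 'M[R]_(m, n)) :
  f @ F --> A -> (fun t => fnorm (f t)) @ F --> fnorm A.
Proof.
by move=> fA; apply: continuous_cvg (cvg_frob fA fA); exact: sqrt_continuous.
Qed.

Lemma cvg_fnorm_dist m n (f : T -> 'M[R]_(m, n)) (A : 'M[R]_(m, n)) :
  f @ F --> A -> (fun t => fnorm (f t - A)) @ F --> (0 : R).
Proof.
move=> fA; rewrite -(@fnorm0 _ m n) -(subrr A).
by apply: cvg_fnorm; apply: cvgB fA _; exact: cvg_cst.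
Qed.

Lemma fnorm_lt_cvg m n (f : T -> 'M[R]_(m, n)) (A : 'M[R]_(m, n)) :
  (forall e : R, 0 < e -> \forall t \near F, fnorm (f t - A) < e) -> f @ F --> A.
Proof.
move=> fA; apply/cvg_mxP => i j; apply/cvgrPdist_lt => e /fA.
apply: filterS => t; rewrite fnormB => /(le_lt_trans (ler_entry_fnorm _ i j)).
by rewrite !mxE.
Qed.

Lemma cvg_det n (f : T -> 'M[R]_n) (A : 'M[R]_n) :
  f @ F --> A -> (fun t => \det (f t)) @ F --> \det A.
Proof.
move=> /cvg_mxP fA; apply: cvg_big => [|s _]; first exact: add_continuous.
apply: cvgM; first exact: cvg_cst.
by apply: cvg_big => [|i _]; [exact: mul_continuous|exact: fA].
Qed.

Lemma near_unitmx n (f : T -> 'M[R]_n) (A : 'M[R]_n) :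
  f @ F --> A -> A \in unitmx -> \forall t \near F, f t \in unitmx.
Proof.
move=> /cvg_det fA; rewrite unitmxE unitfE => /(cvgr_neq0 _ fA).
by apply: filterS => t; rewrite unitmxE unitfE.
Qed.

Lemma cvg_invmx n (f : T -> 'M[R]_n) (A : 'M[R]_n) :
  f @ F --> A -> A \in unitmx -> (fun t => invmx (f t)) @ F --> invmx A.
Proof.
move=> fA Au; have fu := near_unitmx fA Au.
(* [invmx] is defined by cases; the adjugate formula describes it at units, hence eventually along
   [F]. *)
have : (fun t => (\det (f t))^-1 *: \adj (f t)) @ F --> invmx A.
  rewrite /invmx Au; apply: cvgZ.
    by apply: cvgV; [rewrite -unitfE -unitmxE|exact: cvg_det].
  apply/cvg_mxP => i j; rewrite mxE; under eq_cvg do rewrite mxE.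
  apply: cvgM; first exact: cvg_cst.
  apply: cvg_det; apply/cvg_mxP => k l; rewrite !mxE; under eq_cvg do rewrite !mxE.
  by move/cvg_mxP: fA; apply.
apply: cvg_trans; apply: near_eq_cvg; apply: filterS fu => t ftu.
by rewrite /invmx ftu.
Qed.

End MatrixLimits.

(** * Tangent cones of the matrices of bounded rank *)

Section TangentCone.
Context {R : realType}.

Section PerturbedInverse.
Context {m n : nat}.
Implicit Types (Z A : 'M[R]_(m, n)) (H : 'M[R]_(n, m)).

(** The matrix [H'] of [outer_inverse_perturbation] for the base point [A] and the perturbation
    [Z - A]. *)
Definition perturbed_inverse A H Z : 'M[R]_(n, m) :=
  H *m invmx (1%:M + (Z - A) *m H).

Context {T : Type} {F : set_system T} {FF : Filter F}.
Implicit Types (f : T -> 'M[R]_(m, n)).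

Lemma cvg_perturbed_unit f A H : f @ F --> A ->
  (fun t => 1%:M + (f t - A) *m H) @ F --> (1%:M : 'M[R]_m).
Proof.
move=> fA; have e : 1%:M + (A - A) *m H = 1%:M by rewrite subrr mul0mx addr0.
rewrite -[X in _ --> X]e.
apply: cvgD; first exact: cvg_cst.
by apply: cvg_mulmx; [apply: cvgB fA _|]; exact: cvg_cst.
Qed.

Lemma cvg_perturbed_inverse f A H : f @ F --> A ->
  (fun t => perturbed_inverse A H (f t)) @ F --> H.
Proof.
move=> fA; rewrite -[X in _ --> X]mulmx1 -(invmx1 _ m).
apply: cvg_mulmx; first exact: cvg_cst.
by apply: cvg_invmx (unitmx1 _ _); exact: cvg_perturbed_unit.
Qed.

Lemma near_perturbed_inverse f A H : f @ F --> A -> ginv A H ->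
  \forall t \near F, let H' := perturbed_inverse A H (f t) in
  [/\ H' *m f t *m H' = H', \rank H' = \rank A &
    f t - f t *m H' *m f t = (1%:M - f t *m H') *m (f t - A) *m (1%:M - H *m A)].
Proof.
move=> fA gAH; have [AHA HAH] := gAH.
have uf := near_unitmx (FF := FF) (cvg_perturbed_unit H fA) (unitmx1 _ _).
 apply: filterS uf => t ut /=.
have := outer_inverse_perturbation HAH ut; rewrite /= (addrC A) subrK => -[? rk H'A].
by split=> //; [rewrite rk; exact: ginv_rank|exact: H'A].
Qed.

(** Lower semicontinuity of the rank: an outer inverse of rank [\rank A] survives near [A]. *)
Lemma near_rank f A : f @ F --> A -> \forall t \near F, (\rank A <= \rank (f t))%N.
Proof.
move=> fA; have [H gAH] := ginv_exists A.
apply: filterS (near_perturbed_inverse fA gAH) => t /= [H'H' <- _].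
by rewrite -{1}H'H'; apply: leq_trans (mxrankM_maxl _ _) (mxrankM_maxr _ _).
Qed.

(** The outer identity persists near [A]; constancy of the rank then gives the inner one. *)
Lemma near_ginv f A H : f @ F --> A -> ginv A H ->
  \forall t \near F, \rank (f t) = \rank A -> ginv (f t) (perturbed_inverse A H (f t)).
Proof.
move=> fA gAH; apply: filterS (near_perturbed_inverse fA gAH) => t /= [H'H' rk _] rkf.
by apply: ginv_of_outer_inverse => //; rewrite rk rkf.
Qed.

Lemma cvg_normal_part f (h : T -> 'M[R]_(n, m)) A H (V G : 'M[R]_(m, n)) :
  f @ F --> A -> h @ F --> H ->
  (fun t => V - normal_part (f t) (h t) G) @ F --> V - normal_part A H G.
Proof.
move=> fA hH; apply: cvgB; first exact: cvg_cst; rewrite /normal_part.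
apply: cvg_mulmx; first apply: cvg_mulmx; last first.
- by apply: cvgB; [exact: cvg_cst|exact: cvg_mulmx].
- exact: cvg_cst.
- by apply: cvgB; [exact: cvg_cst|exact: cvg_mulmx].
Qed.

(** The difference is the quadratic term of the curve, and its coefficient is controlled by a
    product of norms that converges. *)
Lemma near_tangent_curve_dist f A H : f @ F --> A ->
  exists2 K : R, 0 < K & \forall t \near F, forall G : 'M[R]_(m, n),
    fnorm (f t + G - tangent_curve (f t) (perturbed_inverse A H (f t)) G) <= K * fnorm G ^+ 2.
Proof.
move=> fA; pose h t := perturbed_inverse A H (f t).
have hH : h @ F --> H by exact: cvg_perturbed_inverse.
have : (fun t => fnorm (1%:M - f t *m h t) * fnorm (h t)) @ F -->
    fnorm (1%:M - A *m H) * fnorm H.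
  apply: cvgM; last exact: cvg_fnorm.
  by apply: cvg_fnorm; apply: cvgB; [exact: cvg_cst|exact: cvg_mulmx].
set K := (X in _ --> X) => cK.
exists (K + 1); first by rewrite ltr_wpDl // mulr_ge0 // fnorm_ge0.
have K1 : K < K + 1 by rewrite ltrDl.
apply: filterS (cvgr_lt _ cK _ K1) => t /ltW Kt G.
rewrite /tangent_curve opprD addrA subrr sub0r fnormN -/(h t).
apply: le_trans (ler_fnormM _ _) _; rewrite expr2 mulrA ler_wpM2r ?fnorm_ge0 //.
apply: le_trans (ler_fnormM _ _) _.
apply: le_trans (ler_wpM2r (fnorm_ge0 _) (ler_fnormM _ _)) _.
by rewrite mulrAC ler_wpM2r // fnorm_ge0.
Qed.

End PerturbedInverse.

Context {m n : nat}.
Implicit Types (X Z G V : 'M[R]_(m, n)) (H : 'M[R]_(n, m)).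

(** The residuals of the [x i] have rank at most [r - \rank Z] by [rank_outer_inverse]. Divided by
    [t i] they converge to the normal part of [G], and the rank is lower semicontinuous. *)
Lemma tangent_cone_rank r Z H G : ginv Z H -> tangent_cone (rank_le r) Z G ->
  (\rank (normal_part Z H G) + \rank Z <= r)%N.
Proof.
move=> gZH [x [t [xr t0 xZ xG]]].
pose h i := perturbed_inverse Z H (x i).
have : (fun i => (1%:M - x i *m h i) *m ((t i)^-1 *: (x i - Z)) *m (1%:M - H *m Z)) @ \oo
    --> normal_part Z H G.
  apply: cvg_mulmx; last exact: cvg_cst.
  apply: cvg_mulmx xG; apply: cvgB; first exact: cvg_cst.
  by apply: cvg_mulmx => //; exact: cvg_perturbed_inverse.
move=> /near_rank rkN; have near_h := near_perturbed_inverse xZ gZH.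
have [i []] := filter_ex (filterI rkN (near_h _)).
rewrite /= -/(h i) => rki [hxh rkh xE].
rewrite -scalemxAr -scalemxAl -xE in rki.
apply: leq_trans (xr i); rewrite -rkh; apply: leq_trans (rank_outer_inverse hxh).
by rewrite leq_add2r; apply: leq_trans rki (mxrank_scale _ _).
Qed.

Lemma rank_le_tangent_curve r Z H G a : ginv Z H ->
  (\rank (normal_part Z H G) + \rank Z <= r)%N ->
  rank_le r (tangent_curve Z H (a *: G)).
Proof.
move=> gZH rkG; apply: leq_trans (tangent_curve_rank _ gZH) _.
apply: leq_trans rkG; rewrite addnC leq_add2r normal_partZ.
exact: mxrank_scale.
Qed.

(** The curve along [a *: G] stays in [rank_le r] and equals [Z + a *: G] up to a term of order
    [a ^+ 2]; it is sampled at the harmonic sequence. *)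
Lemma tangent_cone_of_rank r Z H G : ginv Z H ->
  (\rank (normal_part Z H G) + \rank Z <= r)%N -> tangent_cone (rank_le r) Z G.
Proof.
move=> gZH rkG; pose K := (1%:M - Z *m H) *m G *m H *m G.
have curveE a : tangent_curve Z H (a *: G) = Z + a *: (G + a *: K).
  by rewrite /tangent_curve -!scalemxAr -!scalemxAl scalerDr -addrA.
have GaK : (fun i => G + @harmonic R i *: K) @ \oo --> G.
  have e : G + (0 : R) *: K = G by rewrite scale0r addr0.
  rewrite -[X in _ --> X]e.
  by apply: cvgD; [exact: cvg_cst|apply: cvgZr_tmp; exact: cvg_harmonic].
exists (fun i => Z + @harmonic R i *: (G + @harmonic R i *: K)), (@harmonic R).
split=> [i|i||]; first by rewrite -curveE; exact: rank_le_tangent_curve.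
- exact: harmonic_gt0.
- have e : Z + (0 : R) *: G = Z by rewrite scale0r addr0.
  rewrite -[X in _ --> X]e.
  apply: cvgD; first exact: cvg_cst.
  by apply: cvgZ => //; exact: cvg_harmonic.
- apply: cvg_trans GaK; apply: near_eq_cvg; near=> i.
  by rewrite (addrC Z) addrK scalerA mulVf ?scale1r // gt_eqF // harmonic_gt0.
Unshelve. all: by end_near. Qed.

(* On the stratum of constant rank the tangent cone is inner semicontinuous. *)
Lemma near_tangent_cone r X V : tangent_cone (rank_le r) X V ->
  exists2 W : 'M[R]_(m, n) -> 'M[R]_(m, n), W Z @[Z --> X] --> V &
    \forall Z \near X, \rank Z = \rank X -> tangent_cone (rank_le r) Z (W Z).
Proof.
have [H gXH] := ginv_exists X.
move=> /(tangent_cone_rank gXH) rkV.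
pose h := perturbed_inverse X H.
have hH : h Z @[Z --> X] --> H.
  exact: (cvg_perturbed_inverse (F := nbhs X) (f := id) (@cvg_id _ _)).
(* The normal part at [Z] of this witness is that of [normal_part X H V], so its rank is at most
   that of the normal part of [V] at [X]. *)
exists (fun Z => V - normal_part Z (h Z) (V - normal_part X H V)).
  have e : V - normal_part X H (V - normal_part X H V) = V.
    by rewrite normal_partB normal_partK // subrr subr0.
  rewrite -[X in _ --> X]e.
  exact: (cvg_normal_part (f := id) (F := nbhs X) (@cvg_id _ _) hH).
have := near_ginv (f := id) (F := nbhs X) (@cvg_id _ _) gXH.
move=> /(_ _); apply: filterS => Z /= gZ rkZ; have {}gZ := gZ rkZ.
apply: (tangent_cone_of_rank gZ); rewrite -/(h Z) in gZ *.
rewrite rkZ normal_partB normal_partK // -normal_partB opprB addrC subrK.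
by apply: leq_trans rkV; rewrite leq_add2r rank_normal_part.
Qed.

(** The tangent curve supplies a competitor of rank at most [r] at quadratic distance. *)
Lemma near_proj_rank_le_dist r X : exists2 K : R, 0 < K &
  \forall Z \near X, \rank Z = \rank X -> forall G Y,
    tangent_cone (rank_le r) Z G -> Defs.proj (rank_le r) (Z + G) Y ->
    fnorm (Z + G - Y) <= K * fnorm G ^+ 2.
Proof.
have [H gXH] := ginv_exists X.
have [K K0 nearK] := near_tangent_curve_dist (F := nbhs X) (f := id) H (@cvg_id _ _).
exists K => //.
have := near_ginv (f := id) (F := nbhs X) (@cvg_id _ _) gXH.
move=> /(_ _); apply: filterS2 nearK => Z ZK gZ rkZ G Y tG [_ Ymin].
apply: le_trans (ZK G); apply: Ymin; have gZH := gZ rkZ.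
by rewrite -[G]scale1r; apply: rank_le_tangent_curve => //; exact: tangent_cone_rank tG.
Qed.

End TangentCone.

(** * Descent estimates and projections onto cones *)

Section Descent.
Context {R : realType} {m n : nat}.
Implicit Types (X Y Z V W G : 'M[R]_(m, n)) (f : 'M[R]_(m, n) -> R).

Lemma nbhs_fnorm X (U : set 'M[R]_(m, n)) : nbhs X U ->
  exists2 e : R, 0 < e & forall Z, fnorm (Z - X) < e -> U Z.
Proof.
move=> /nbhs_ballP[e /= e0 eU]; exists e => // Z ZX; apply: eU; split=> // i j.
rewrite /ball /= distrC; apply: le_lt_trans ZX.
by have := ler_entry_fnorm (Z - X) i j; rewrite !mxE.
Qed.

Lemma near_fnorm X (e : R) : 0 < e -> \forall Z \near X, fnorm (Z - X) < e.
Proof.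
move=> e0.
exact: (cvgr_lt _ (cvg_fnorm_dist (F := nbhs X) (f := id) (@cvg_id _ _)) _ e0).
Qed.

Lemma is_derive_line f X V (t : R) : differentiable f (X + t *: V) ->
  is_derive t (1 : R) (fun s : R => f (X + s *: V)) (frob (grad f (X + t *: V)) V).
Proof.
set Z := X + t *: V => df; set g := fun s : R => _.
have gE : (fun h : R => h^-1 *: ((g \o shift t) (h *: (1 : R)) - g t)) =
          (fun h : R => h^-1 *: ((f \o shift Z) (h *: V) - f Z)).
  apply/funext => h; congr (_ *: (f _ - _)).
  by rewrite /= [h *: 1]mulr1 scalerDl addrCA.
apply: DeriveDef; first by rewrite /derivable gE; exact: diff_derivable.
by rewrite /derive gE -gradE; exact: deriveE.
Qed.

(** The mean value theorem on the segment; using it instead of an integral gives the constant [L]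
    rather than [L / 2]. *)
Lemma descent_bound f X Y (L : R) : 0 <= L -> (forall Z, differentiable f Z) ->
  (forall t : R, 0 <= t <= 1 ->
    fnorm (grad f (X + t *: (Y - X)) - grad f X) <= L * fnorm (t *: (Y - X))) ->
  f Y <= f X + frob (grad f X) (Y - X) + L * fnorm (Y - X) ^+ 2.
Proof.
move=> L0 df fL; pose g (s : R) := f (X + s *: (Y - X)).
have dg (s : R) : is_derive s (1 : R) g (frob (grad f (X + s *: (Y - X))) (Y - X)).
  exact: is_derive_line.
have cg : {within `[0, 1], continuous g}.
  apply: derivable_within_continuous => s _; exact: ex_derive.
have [t t01] := MVT (@ltr01 R) (fun s _ => dg s) cg.
rewrite /g scale1r scale0r addr0 subrKC subr0 mulr1 => fE.
have {t01} /andP[t0 t1] : 0 <= t <= 1 by move: t01; rewrite in_itv /= => /andP[/ltW -> /ltW].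
have := cauchy_schwarz (grad f (X + t *: (Y - X)) - grad f X) (Y - X).
rewrite frobBl -[X in X - _]fE => CS.
have := fL t; rewrite t0 t1 fnormZ ger0_norm // => /(_ isT) {}fL.
have N0 := fnorm_ge0 (Y - X).
have : fnorm (grad f (X + t *: (Y - X)) - grad f X) * fnorm (Y - X) <=
       L * fnorm (Y - X) ^+ 2.
  rewrite expr2 mulrA ler_wpM2r //; apply: le_trans fL _.
  by rewrite ler_wpM2l // ler_piMl.
move/(le_trans CS); rewrite !lerBlDr => /le_trans; apply.
by rewrite addrC addrA addrAC.
Qed.

(** Along the ray of [G], the squared distance to [X] is a quadratic function of the scale, minimal
    at scale 1. *)
Lemma proj_cone_frob (S : set 'M[R]_(m, n)) X G : Defs.proj S X G ->
  (forall a : R, 0 < a -> S (a *: G)) -> frob X G = fnorm G ^+ 2.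
Proof.
move=> [SG Gmin] Sc.
have key (a : R) : 0 < a -> 2 * (a - 1) * frob X G <= (a ^+ 2 - 1) * fnorm G ^+ 2.
  move=> a0; have := Gmin _ (Sc _ a0).
  rewrite -ler_sqr ?nnegrE ?fnorm_ge0 // !sqr_fnorm.
  rewrite !(frobDl, frobDr, frobNl, frobNr, frobZl, frobZr) (frobC G X) -(sqr_fnorm G).
  by lra.
have := sqr_ge0 (fnorm G); move: (fnorm G ^+ 2) (frob X G) key => b a key b0.
(* The optimal scale is [a / b]. Scale [2^-1] settles [2 * a <= b], where the quotient may fail to
   be positive, and scale 2 settles [b = 0]. *)
have [ab|ba|//] := ltgtP a b.
  have [ab2|ab2] := leP (2 * a) b.
    by have := key 2^-1 ltac:(lra); rewrite expr2; nra.
  have a0 : 0 < a by lra.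
  have bp : 0 < b by lra.
  have := key (a / b) (divr_gt0 a0 bp).
  rewrite -(ler_pM2l (mulr_gt0 bp bp)).
  have -> : b * b * (2 * (a / b - 1) * a) = 2 * (a - b) * a * b by field; rewrite gt_eqF.
  have -> : b * b * (((a / b) ^+ 2 - 1) * b) = (a - b) * (a + b) * b by field; rewrite gt_eqF.
  by rewrite ler_pM2r // => H; nra.
have [bp|b_le0] := ltP 0 b; last by have := key 2 ltac:(lra); rewrite expr2; nra.
have a0 : 0 < a by lra.
have := key (a / b) (divr_gt0 a0 bp).
rewrite -(ler_pM2l (mulr_gt0 bp bp)).
have -> : b * b * (2 * (a / b - 1) * a) = 2 * (a - b) * a * b by field; rewrite gt_eqF.
have -> : b * b * (((a / b) ^+ 2 - 1) * b) = (a - b) * (a + b) * b by field; rewrite gt_eqF.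
by rewrite ler_pM2r // => H; nra.
Qed.

Lemma tangent_coneZ (S : set 'M[R]_(m, n)) X V (a : R) :
  0 < a -> tangent_cone S X V -> tangent_cone S X (a *: V).
Proof.
move=> a0 [x [t [xS t0 xX xV]]]; exists x, (fun i => t i / a); split=> // [i|].
  by rewrite divr_gt0.
have : (fun i => a *: ((t i)^-1 *: (x i - X))) @ \oo --> a *: V.
  by apply: cvgZ xV; exact: cvg_cst.
apply: cvg_trans; apply: near_eq_cvg; near=> i.
by rewrite scalerA invf_div.
Unshelve. all: by end_near. Qed.

Section FixedRank.
Variables (f : 'M[R]_(m, n) -> R) (r : nat).

Lemma descent_direction_frob X G : descent_directions f r X G ->
  frob (- grad f X) G = fnorm G ^+ 2.
Proof.
move=> pG; apply: proj_cone_frob (pG) _ => a a0.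
by apply: tangent_coneZ => //; case: pG.
Qed.

(** By orthogonality, [fnorm (- grad f X - G) ^+ 2] is [fnorm (- grad f X) ^+ 2 - fnorm G ^+ 2], so
    all minimizers have the same norm; the existence of [G] rules out the default 0 of [xget]. *)
Lemma stationarity_measureE X G : descent_directions f r X G ->
  stationarity_measure f r X = fnorm G.
Proof.
rewrite /stationarity_measure => dG.
have [|G' dG' <-] := xgetPex 0 (P := fnorm @` descent_directions f r X).
  by exists (fnorm G), G.
have dist (K : 'M[R]_(m, n)) : descent_directions f r X K ->
    fnorm (- grad f X - K) ^+ 2 = fnorm (- grad f X) ^+ 2 - fnorm K ^+ 2.
  move=> /descent_direction_frob; move: (- grad f X) => g gK.
  rewrite !sqr_fnorm !(frobDl, frobDr, frobNl, frobNr) (frobC K g) gK -!sqr_fnorm.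
  by ring.
have le (K K' : 'M[R]_(m, n)) : descent_directions f r X K ->
    descent_directions f r X K' -> fnorm K' <= fnorm K.
  move=> dK dK'; have [_ /(_ K')] := dK.
  have [tK' _] := dK'; move=> /(_ tK').
  rewrite -ler_sqr ?nnegrE ?fnorm_ge0 // !dist // => H.
  by rewrite -ler_sqr ?nnegrE ?fnorm_ge0 //; lra.
by apply/le_anti; rewrite !le.
Qed.

Lemma ler_fnorm_descent_direction X G : descent_directions f r X G ->
  fnorm G <= fnorm (grad f X).
Proof.
move=> /descent_direction_frob fG; have := cauchy_schwarz (- grad f X) G.
rewrite fG fnormN expr2; have := fnorm_ge0 G; rewrite le_eqVlt => /orP[/eqP<- _|G0].
  exact: fnorm_ge0.
by rewrite ler_pM2r.
Qed.

(** [G] is compared with the competitor [a *: W]; the scale [a] is left free for later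
    optimization. *)
Lemma fnorm_descent_direction_ge X G W (a : R) : 0 < a ->
  descent_directions f r X G -> tangent_cone (rank_le r) X W ->
  2 * a * frob (- grad f X) W - a ^+ 2 * fnorm W ^+ 2 <= fnorm G ^+ 2.
Proof.
move=> a0 dG tW; have [_ /(_ _ (tangent_coneZ a0 tW))] := dG.
have := descent_direction_frob dG; move: (- grad f X) => g fG.
rewrite -ler_sqr ?nnegrE ?fnorm_ge0 // !sqr_fnorm.
rewrite !(frobDl, frobDr, frobNl, frobNr, frobZl, frobZr) (frobC G g) (frobC W g) fG.
by rewrite -!sqr_fnorm; lra.
Qed.

Hypothesis df : forall X, differentiable f X.
Hypothesis lip : locally_lipschitz (grad f).

Lemma cvg_grad X : grad f Z @[Z --> X] --> grad f X.
Proof.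
have [L [U /nbhs_fnorm[e e0 eU] UL]] := lip X.
apply: (fnorm_lt_cvg (F := nbhs X)) => d d0.
(* The constant [L] has unknown sign, hence the denominator with its absolute value. *)
have de0 : 0 < Num.min e (d / (`|L| + 1)).
  by rewrite lt_min e0 divr_gt0 // ltr_wpDl.
apply: filterS (near_fnorm X de0) => Z; rewrite lt_min => /andP[ZXe ZXd].
apply: le_lt_trans (UL _ _ (eU _ ZXe) (eU _ _)) _; first by rewrite subrr fnorm0.
move: ZXd; rewrite ltr_pdivlMr ?ltr_wpDl // => /le_lt_trans; apply.
rewrite mulrC ler_wpM2l ?fnorm_ge0 //.
by rewrite (le_trans (ler_norm L)) // lerDl.
Qed.

End FixedRank.
End Descent.

(** * Uniform decrease of P2GD near a point that is not B-stationary *)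

Section NearDescent.
Context {R : realType} {m n : nat}.
Implicit Types (X Y Z V W G : 'M[R]_(m, n)).
Variables (f : 'M[R]_(m, n) -> R) (r : nat).
Hypothesis df : forall X, differentiable f X.
Hypothesis lip : locally_lipschitz (grad f).

(** The step [k / (2 * K ^+ 2)] maximizes [a * k - a ^+ 2 * K ^+ 2] over [a]. *)
Lemma quadratic_step_bound (k K p q : R) : 0 < k -> 0 < K -> k / 2 <= p -> q <= K ^+ 2 ->
  k ^+ 2 / (4 * K ^+ 2) <= 2 * (k / (2 * K ^+ 2)) * p - (k / (2 * K ^+ 2)) ^+ 2 * q.
Proof.
move=> k0 K0 kp qK.
have -> : k ^+ 2 / (4 * K ^+ 2) =
    2 * (k / (2 * K ^+ 2)) * (k / 2) - (k / (2 * K ^+ 2)) ^+ 2 * K ^+ 2.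
  by field; rewrite gt_eqF.
have w0 : 0 <= k / (2 * K ^+ 2).
  by apply: divr_ge0; [exact: ltW|apply: mulr_ge0; [|exact: sqr_ge0]].
by apply: lerB; rewrite ler_wpM2l ?sqr_ge0 // mulr_ge0.
Qed.

(** Some tangent [V] at [X] has a positive inner product with [- grad f X]. By [near_tangent_cone]
    it extends to tangent directions at nearby points of the same rank, each bounding the norm of
    [G] from below. *)
Lemma near_stationarity X : rank_le r X -> ~ B_stationary f r X ->
  exists2 d : R, 0 < d & \forall Z \near X, \rank Z = \rank X ->
    forall G, descent_directions f r Z G -> d <= fnorm G ^+ 2.
Proof.
move=> rX nB.
have [V tV Vg] : exists2 V, tangent_cone (rank_le r) X V & 0 < frob (- grad f X) V.
  apply: contrapT => H; apply: nB; split=> // V tV; rewrite leNgt frobC.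
  by apply/negP => Vg; apply: H; exists V.
have [W cW tW] := near_tangent_cone tV.
have cg : - grad f Z @[Z --> X] --> - grad f X by exact: cvgN (cvg_grad lip (X := X)).
have [k k0 nk] : exists2 k : R, 0 < k &
    \forall Z \near X, k / 2 < frob (- grad f Z) (W Z).
  exists (frob (- grad f X) V) => //.
  apply: (cvgr_gt _ (cvg_frob (F := nbhs X) cg cW)).
  by rewrite ltr_pdivrMr // ltr_pMr // ltr1n.
have [K K0 nK] : exists2 K : R, 0 < K & \forall Z \near X, fnorm (W Z) < K.
  exists (fnorm V + 1); first by rewrite ltr_wpDl // fnorm_ge0.
  by apply: (cvgr_lt _ (cvg_fnorm (F := nbhs X) cW)); rewrite ltrDl.
exists (k ^+ 2 / (4 * K ^+ 2)); first by rewrite divr_gt0 ?mulr_gt0 ?exprn_gt0.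
have a0 : 0 < k / (2 * K ^+ 2) by rewrite divr_gt0 ?mulr_gt0 ?exprn_gt0.
apply: filterS3 tW nk nK => Z tW /ltW kZ KZ rkZ G dG.
apply: le_trans (fnorm_descent_direction_ge a0 dG (tW rkZ)).
have W2 : fnorm (W Z) ^+ 2 <= K ^+ 2.
  by rewrite ler_sqr ?nnegrE ?fnorm_ge0 ?(ltW K0) // ltW.
exact: quadratic_step_bound.
Qed.

(** The three terms on the left are the first-order gain, the effect of the projection error, and
    the second-order remainder. *)
Lemma armijo_bound (a B K L c q : R) : 0 <= a -> 0 <= q -> a * (B * K + 4 * L) <= 1 - c ->
  - (a * q) + B * (K * (a ^+ 2 * q)) + L * (4 * (a ^+ 2 * q)) <= - (c * a * q).
Proof.
move=> a0 q0 aC; rewrite -subr_ge0.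
have -> : - (c * a * q) - (- (a * q) + B * (K * (a ^+ 2 * q)) + L * (4 * (a ^+ 2 * q))) =
  (1 - c - a * (B * K + 4 * L)) * (a * q) by ring.
by rewrite mulr_ge0 ?subr_ge0 // mulr_ge0.
Qed.

Lemma near_armijo X (c : R) : c < 1 ->
  exists2 a0 : R, 0 < a0 & \forall Z \near X, \rank Z = \rank X -> rank_le r Z ->
    forall G Y a, descent_directions f r Z G -> 0 < a -> a <= a0 ->
      Defs.proj (rank_le r) (Z + a *: G) Y ->
      f Y <= f Z - c * a * stationarity_measure f r Z ^+ 2.
Proof.
move=> c1; have [K K0 nK] := near_proj_rank_le_dist r X.
have [L0 [U /nbhs_fnorm[e e0 eU] UL]] := lip X.
pose L := `|L0| + 1; pose B := fnorm (grad f X) + 1.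
have L_gt0 : 0 < L by rewrite ltr_wpDl.
have B0 : 0 < B by rewrite ltr_wpDl // fnorm_ge0.
have BltB : fnorm (grad f X) < B by rewrite ltrDl.
have nB := cvgr_lt _ (cvg_fnorm (F := nbhs X) (cvg_grad lip (X := X))) _ BltB.
have C0 : 0 < B * K + 4 * L by rewrite addr_gt0 ?mulr_gt0.
(* The first bound keeps the segment from [Z] to [Y] in the ball of radius [e] around [X]; the
   second is the condition of [armijo_bound]. *)
exists (Num.min (e / (4 * B)) ((1 - c) / (B * K + 4 * L))).
  by rewrite lt_min !divr_gt0 ?mulr_gt0 // subr_gt0.
have e2 : 0 < e / 2 by lra.
apply: filterS3 nK (nB _ _) (near_fnorm X e2) => Z ZK ZB Ze rkZ rZ G Y a dG a_gt0.
rewrite le_min => /andP[ae aC] pY.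
rewrite (stationarity_measureE dG).
have fG := descent_direction_frob dG.
have GB : fnorm G <= B by apply: le_trans (ler_fnorm_descent_direction dG) (ltW ZB).
have tG : tangent_cone (rank_le r) Z (a *: G) by apply: tangent_coneZ => //; case: dG.
have YaG : fnorm (Y - (Z + a *: G)) <= K * (a ^+ 2 * fnorm G ^+ 2).
  have := ZK rkZ _ _ tG pY.
  by rewrite fnormB fnormZ (gtr0_norm a_gt0) exprMn.
(* [Z] itself competes in the projection, so [Y] is within [a * fnorm G] of [Z + a *: G]. *)
have YZ : fnorm (Y - Z) <= 2 * a * fnorm G.
  have [_ /(_ _ rZ)] := pY.
  rewrite [X in _ <= fnorm X]addrAC subrr add0r fnormZ (gtr0_norm a_gt0) (fnormB _ Y) => D1.
  have -> : Y - Z = (Y - (Z + a *: G)) + a *: G by rewrite opprD addrA subrK.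
  apply: le_trans (ler_fnormD _ _) _; rewrite fnormZ (gtr0_norm a_gt0).
  by rewrite -mulrA [leRHS]mulr_natl mulr2n lerD2r.
have G0 := fnorm_ge0 G; have YZ0 := fnorm_ge0 (Y - Z).
have Ue W : fnorm (W - Z) <= fnorm (Y - Z) -> U W.
  move=> WZ; apply: eU; rewrite -(subrK Z W) -addrA.
  apply: le_lt_trans (ler_fnormD _ _) _.
  have : 2 * a * fnorm G <= e / 2.
    apply: le_trans (_ : 2 * (e / (4 * B)) * B <= _); last first.
      by rewrite le_eqVlt; apply/orP; left; apply/eqP; field; rewrite gt_eqF.
    by rewrite ler_pM // ?mulr_ge0 ?(ltW a_gt0) // ler_wpM2l.
  move=> YZe; rewrite (splitr e); apply: ler_ltD Ze.
  exact: le_trans (le_trans WZ YZ) YZe.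
have fY : f Y <= f Z + frob (grad f Z) (Y - Z) + L * fnorm (Y - Z) ^+ 2.
  apply: (descent_bound (ltW L_gt0) df) => t /andP[t0 t1].
  have tE : Z + t *: (Y - Z) - Z = t *: (Y - Z) by rewrite addrAC subrr add0r.
  rewrite -[in leRHS]tE; apply: le_trans (UL _ _ _ _) _.
  - apply: Ue; rewrite tE fnormZ ger0_norm //.
    by rewrite ler_piMl.
  - by apply: Ue; rewrite subrr fnorm0.
  rewrite ler_wpM2r ?fnorm_ge0 //; apply: le_trans (ler_norm _) _.
  by rewrite lerDl.
apply: le_trans fY _.
have dec : frob (grad f Z) (Y - Z) <=
    - (a * fnorm G ^+ 2) + B * (K * (a ^+ 2 * fnorm G ^+ 2)).
  have -> : Y - Z = (Y - (Z + a *: G)) + a *: G by rewrite opprD addrA subrK.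
  rewrite frobDr frobZr -[in X in _ + X](opprK (grad f Z)).
  rewrite frobNl fG mulrN [leRHS]addrC lerD2r.
  apply: le_trans (cauchy_schwarz _ _) _.
  exact: ler_pM (fnorm_ge0 _) (fnorm_ge0 _) (ltW ZB) YaG.
have quad : L * fnorm (Y - Z) ^+ 2 <= L * (4 * (a ^+ 2 * fnorm G ^+ 2)).
  rewrite ler_wpM2l ?(ltW L_gt0) //.
  have -> : 4 * (a ^+ 2 * fnorm G ^+ 2) = (2 * a * fnorm G) ^+ 2 by ring.
  by rewrite (ler_sqr YZ0 (le_trans YZ0 YZ)).
rewrite -addrA lerD2l; apply: le_trans (lerD dec quad) _.
have aC' : a * (B * K + 4 * L) <= 1 - c by rewrite -ler_pdivlMr.
exact: (armijo_bound (ltW a_gt0) (sqr_ge0 _) aC').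
Qed.

(** Invariant of the loop: the current step is at least [alo], as initially, or at least
    [beta * a0], as after any rejection. *)
Lemma backtrack_decrease X G (beta c alo a0 : R) :
  (forall a Y, 0 < a -> a <= a0 -> Defs.proj (rank_le r) (X + a *: G) Y ->
    f Y <= f X - c * a * stationarity_measure f r X ^+ 2) ->
  0 < beta -> 0 < c ->
  forall a Y Z, alo <= a \/ beta * a0 <= a -> 0 < a ->
    Defs.proj (rank_le r) (X + a *: G) Y -> backtrack f r beta c X G a Y Z ->
    f Z <= f X - c * Num.min alo (beta * a0) * stationarity_measure f r X ^+ 2.
Proof.
move=> armijo beta0 c0 a Y Z aP a_gt0 pY bt.
elim: bt aP a_gt0 pY => {a Y Z} [a Y fY aP a_gt0 _|a Y Y' Z fY pY' _ IH aP a_gt0 pY].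
  apply: le_trans fY _; rewrite lerD2l lerN2 ler_wpM2r ?sqr_ge0 //.
  rewrite ler_wpM2l ?(ltW c0) // ge_min; apply/orP.
  by case: aP; [left|right].
apply: IH => //; last by rewrite mulr_gt0.
(* A rejected step exceeds [a0], since every smaller one passes the Armijo test. *)
right; rewrite mulrC ler_wpM2r ?(ltW beta0) // leNgt; apply/negP => aa0.
by have := armijo _ _ a_gt0 (ltW aa0) pY; rewrite leNgt fY.
Qed.

Lemma near_P2GD_decrease X (alo ahi beta c : R) :
  0 < alo -> 0 < beta -> 0 < c -> c < 1 ->
  rank_le r X -> ~ B_stationary f r X ->
  exists2 d : R, 0 < d & \forall Z \near X, \rank Z = \rank X ->
    forall Y, P2GD f r alo ahi beta c Z Y -> f Y <= f Z - d.
Proof.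
move=> alo0 beta0 c0 c1 rX nB.
have [d d0 nd] := near_stationarity rX nB.
have [a0 a0_gt0 na] := near_armijo X c1.
have m0 : 0 < Num.min alo (beta * a0) by rewrite lt_min alo0 mulr_gt0.
exists (c * Num.min alo (beta * a0) * d); first by rewrite !mulr_gt0.
apply: filterS2 nd na => Z Zd Za rkZ Y [G [a [Y0 [dG /andP[aloa _] pY0 bt]]]].
have rZ : rank_le r Z by rewrite /rank_le /= rkZ.
have armijo a' Y' := Za rkZ rZ G Y' a' dG.
have /le_trans := backtrack_decrease armijo beta0 c0 (or_introl aloa)
  (lt_le_trans alo0 aloa) pY0 bt.
apply; rewrite (stationarity_measureE dG) lerD2l lerN2 ler_wpM2l ?Zd //.
by rewrite ltW // mulr_gt0.
Qed.

Lemma P2GD_rank_le X (alo ahi beta c : R) Y :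
  P2GD f r alo ahi beta c X Y -> rank_le r Y.
Proof.
move=> [G [a [Y0 [_ _ [rY0 _] bt]]]].
by elim: bt rY0 => {a Y0 Y} [//|a Y Y' Z _ [rY' _] _ IH _]; exact: IH.
Qed.

Lemma P2GD_nonincreasing X (alo ahi beta c : R) Y : 0 < alo -> 0 < beta -> 0 < c ->
  P2GD f r alo ahi beta c X Y -> f Y <= f X.
Proof.
move=> alo0 beta0 c0 [G [a [Y0 [_ /andP[aloa _] _ bt]]]].
have a_gt0 := lt_le_trans alo0 aloa.
elim: bt a_gt0 => {a Y0 Y aloa} [a Y fY a0|a Y Y' Z _ _ _ IH a0].
  by apply: le_trans fY _; rewrite gerBl mulr_ge0 ?sqr_ge0 // mulr_ge0 // ltW.
by apply: IH; rewrite mulr_gt0.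
Qed.

End NearDescent.

(** * Singular values above a threshold under perturbation *)

Section SingularValues.
Context {R : realType} {m n : nat}.
Implicit Types (X Z : 'M[R]_(m, n)).

Lemma rank_gtE (D : R) Z :
  let p := char_poly (Z^T *m Z) in
  rank_gt D Z = (\sum_(x <- rootsR p | (D < Num.sqrt x)%R) mup x p)%N.
Proof.
move=> p; rewrite /rank_gt /singular_values -/p count_flatten sumnE !big_map.
rewrite [RHS]big_mkcond; apply: eq_bigr => x _.
by rewrite count_nseq; case: (_ < _)%R; rewrite ?mul1n ?mul0n.
Qed.

Lemma mulmx_tr_fnorm p (v : 'rV[R]_p) : (v *m v^T) 0 0 = fnorm v ^+ 2.
Proof.
rewrite sqr_fnorm frobE big_ord1 mxE.
by apply: eq_bigr => i _; rewrite mxE.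
Qed.

(* Singular values of [Z] above [D] span a space on which [|Z v| > D |v|]; on
   the kernel of [X], [|Z v| <= |Z - X| |v|]. *)
Lemma rank_gt_le_rank (D : R) X Z : 0 < D -> fnorm (Z - X) <= D ->
  (rank_gt D Z <= \rank X)%N.
Proof.
move=> D0 ZX; rewrite rank_gtE -big_filter.
set p := char_poly _; set s := seq.filter _ _.
have us : uniq s by rewrite filter_uniq // uniq_roots.
have symA : (Z^T *m Z)^T = Z^T *m Z by rewrite trmx_mul trmxK.
have [E <- Elt] := sum_mup_char_poly_sym symA us.
rewrite leqNgt; apply/negP => rkE.
(* Dimension count: [E] has dimension larger than [\rank X], the codimension of the kernel. *)
have : (0 < \rank (E :&: kermx X^T)%MS)%N.
  have := mxrank_mul_ker E X^T; have := mxrankM_maxr E X^T.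
  rewrite mxrank_tr => rkEX rkI; rewrite lt0n; apply: contraTneq rkE => I0.
  by rewrite -rkI I0 addn0 -leqNgt.
rewrite lt0n mxrank_eq0 => /rowV0Pn[v]; rewrite sub_capmx => /andP[vE /sub_kermxP vX] v0.
have sD x : x \in s -> D ^+ 2 < x.
  rewrite mem_filter => /andP[Dx _].
  have x0 : 0 < x by rewrite -sqrtr_gt0; exact: lt_trans Dx.
  by rewrite -[X in _ < X]sqr_sqrtr ?(ltW x0) // ltr_sqr ?nnegrE ?sqrtr_ge0 ?(ltW D0).
have := Elt _ _ sD vE v0; apply/negP; rewrite -leNgt.
have -> : v *m (Z^T *m Z) *m v^T = (v *m (Z - X)^T) *m (v *m (Z - X)^T)^T.
  by rewrite linearB mulmxBr vX subr0 trmx_mul trmxK !mulmxA.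
rewrite !mulmx_tr_fnorm -exprMn ler_sqr ?nnegrE ?mulr_ge0 ?fnorm_ge0 ?(ltW D0) //.
apply: le_trans (ler_fnormM _ _) _.
by rewrite fnormT mulrC ler_wpM2r ?fnorm_ge0.
Qed.

End SingularValues.

(** * Decrease of P2GDR and accumulation points *)

Section Accumulation.
Context {R : realType} {m n : nat}.
Variables (f : 'M[R]_(m, n) -> R) (r : nat) (alo ahi beta c D : R).
Hypothesis df : forall X, differentiable f X.
Hypothesis lip : locally_lipschitz (grad f).
Hypotheses (alo0 : 0 < alo) (beta0 : 0 < beta) (c0 : 0 < c) (c1 : c < 1).
Hypothesis D0 : 0 < D.
Implicit Types X Y Z : 'M[R]_(m, n).

Lemma P2GDR_rank_le X Y : P2GDR f r alo ahi beta c D X Y -> rank_le r Y.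
Proof. by move=> [Xh [Xt [_ P2 [i -> _]]]]; exact: P2GD_rank_le (P2 i). Qed.

(** The index 0 leaves the rank unchanged, so the projection there is [X] itself. *)
Lemma P2GDR_nonincreasing X Y : P2GDR f r alo ahi beta c D X Y -> f Y <= f X.
Proof.
move=> [Xh [Xt [pX P2 [i _ Ymin]]]].
apply: le_trans (Ymin ord0) _.
have [_ /(_ X)] := pX ord0; rewrite subn0 subrr fnorm0 => /(_ erefl) Xh0.
have /eqP : fnorm (X - Xh ord0) = 0 by apply/le_anti; rewrite Xh0 fnorm_ge0.
move=> /eqP/fnorm_eq0/eqP; rewrite subr_eq0 => /eqP XE.
by rewrite [X in _ <= f X]XE; exact: P2GD_nonincreasing (P2 ord0).
Qed.

(* For [Z] near [X], one of the rank reductions of [Z] has the rank of [X]: it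
   is at most as far from [Z] as [X] is, so [near_P2GD_decrease] applies there. *)
Lemma near_P2GDR_decrease X : rank_le r X -> ~ B_stationary f r X ->
  exists2 d : R, 0 < d & \forall Z \near X,
    forall Y, P2GDR f r alo ahi beta c D Z Y -> f Y <= f X - d.
Proof.
move=> rX nB.
have [d d0 nd] := near_P2GD_decrease df lip ahi alo0 beta0 c0 c1 rX nB.
have d2 : 0 < d / 2 by rewrite divr_gt0.
have cf : f @ X --> f X by exact: differentiable_continuous.
have fd : f X < f X + d / 2 by rewrite ltrDl.
have [e e0 eP] := nbhs_fnorm (filterI nd (cvgr_lt _ cf _ fd)).
(* The other half of [d] absorbs the excess over [f X] of the value of [f] at the reduced point. *)
exists (d / 2) => //.
have e2 : 0 < e / 2 by rewrite divr_gt0.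
have nrk := near_rank (F := nbhs X) (f := id) (@cvg_id _ _).
apply: filterS3 (nrk _) (near_fnorm X e2) (near_fnorm X D0) => Z /= rkZ Ze ZD Y.
move=> [Xh [Xt [pX P2 [i -> Ymin]]]] {Y}.
(* Reducing to rank [\rank X] is among the trials because at most [\rank X] singular values of [Z]
   exceed [D]. *)
have jP : (\rank Z - \rank X < (\rank Z - rank_gt D Z).+1)%N.
  by rewrite ltnS leq_sub2l // rank_gt_le_rank // ltW.
pose j := Ordinal jP; apply: le_trans (Ymin j) _.
have [rkj /(_ X)] := pX j; move: rkj; rewrite /rank_eq /= subKn // => rkj /(_ erefl) dj.
have Xe : fnorm (Xh j - X) < e.
  have := ler_fnormD (Xh j - Z) (Z - X); rewrite addrA subrK => /le_lt_trans; apply.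
  by rewrite (splitr e) (fnormB _ Z); exact: ler_ltD (le_trans dj (ltW Ze)) Ze.
have [/(_ rkj _ (P2 j)) /le_trans dec fX] := eP _ Xe.
apply: dec; rewrite lerBlDr; apply: le_trans (ltW fX) _.
by rewrite -addrA lerD2l [X in _ <= _ + X]splitr addKr.
Qed.

(** If [X] were not B-stationary, one iterate near [X] would push all later values down to [f X - d]
    or below, whereas continuity brings later values above [f X - d]. *)
Lemma cluster_P2GDR_stationary (u : nat -> 'M[R]_(m, n)) X :
  rank_le r (u 0%N) -> (forall i, P2GDR f r alo ahi beta c D (u i) (u i.+1)) ->
  cluster (u @ \oo) X -> B_stationary f r X.
Proof.
move=> r0 uP uX.
have freq (N : nat) (A : set 'M[R]_(m, n)) : nbhs X A -> exists2 i, (N <= i)%N & A (u i).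
  move=> XA; have [|_ [[i Ni <-] Ai]] := uX [set u i | i in [set i | (N <= i)%N]] A _ XA.
    by exists N => // i Ni; exists i.
  by exists i.
have ru i : rank_le r (u i) by case: i => // i; exact: P2GDR_rank_le (uP i).
(* The rank bound passes to the accumulation point by lower semicontinuity. *)
have rX : rank_le r X.
  have := near_rank (F := nbhs X) (f := id) (@cvg_id _ _).
  by move=> /(_ _)/(freq 0%N)[i _ /leq_trans]; apply; exact: ru.
have mono i j : (i <= j)%N -> f (u j) <= f (u i).
  move=> /subnK <-; elim: (j - i)%N => // k IH.
  exact: le_trans (P2GDR_nonincreasing (uP _)) IH.
apply: contrapT => nB.
have [d d0 /(freq 0%N)[i _ /(_ _ (uP i)) fi]] := near_P2GDR_decrease rX nB.
have cf : f @ X --> f X by exact: differentiable_continuous.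
have fd : f X - d < f X by rewrite ltrBlDr ltrDl.
have [j ij] := freq i.+1 _ (cvgr_gt _ cf _ fd).
by apply/negP; rewrite -leNgt; exact: le_trans (mono _ _ ij) fi.
Qed.

End Accumulation.

Theorem theorem6p3 (R : realType) (m n r : nat)
    (f : 'M[R]_(m, n) -> R) (alo ahi beta c D : R)
    (x : nat -> option 'M[R]_(m, n)) :
  (0 < m)%N -> (0 < n)%N -> (0 < r)%N -> (r < minn m n)%N ->
  (forall X, differentiable f X) -> locally_lipschitz (grad f) ->
  0 < alo -> alo <= ahi -> 0 < beta -> beta < 1 -> 0 < c -> c < 1 -> 0 < D ->
  generated_by_P2GDR f r alo ahi beta c D x ->
  (forall N X, x N = Some X -> x N.+1 = None -> B_stationary f r X) /\
  (forall u : nat -> 'M[R]_(m, n), (forall i, x i = Some (u i)) ->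
    forall X, cluster (u @ \oo) X -> B_stationary f r X).
Proof.
move=> _ _ _ _ df lip alo0 _ beta0 _ c0 c1 D0 [[X0 x0 rX0] xS xB _].
split=> [N X xN xN1|u xu X uX].
  apply: contrapT => nB; have [Y] := xS N X xN nB.
  by rewrite xN1.
have uP i : P2GDR f r alo ahi beta c D (u i) (u i.+1).
  (* A B-stationary term would be followed by [None], which an infinite sequence excludes. *)
  have [Bi|nBi] := pselect (B_stationary f r (u i)).
    by have := xB i _ (xu i) Bi; rewrite xu.
  by have [Y] := xS i _ (xu i) nBi; rewrite xu => -[->].
have u0 : rank_le r (u 0%N) by move: x0; rewrite xu => -[->].
exact: (cluster_P2GDR_stationary df lip alo0 beta0 c0 c1 D0 u0 uP uX).
Qed.
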